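(* Let $q$ be a prime power, let $n,k,r,\rho$ be positive integers, and let $\mathbb{C}\subseteq\mathbb{F}_q^{n\times n}$ be a linear cover-metric code of $\mathbb{F}_q$-dimension $k$ that has $(r,\rho)$ cover-locality. Then its minimum cover distance $d_C(\mathbb{C})$ satisfies $$d_C(\mathbb{C})\leq n-\frac{k}{n}+1-\left(\left\lceil\frac{k}{nr}\right\rceil-1\right)(\rho-1).$$
   Context: Notation: $[n]=\{1,\dots,n\}$ and $\mathbb{F}_q$ is the finite field with $q$ elements. Cover metric: for $\mathbf{E}=(e_{ij})\in\mathbb{F}_q^{m\times n}$, a line of $\mathbf{E}$ is a row or a column; the lines are indexed by $[m+n]$, where $i\in[m]$ is the $i$-th row and $m+j$ (for $j\in[n]$) is the $j$-th column. A cover of $\mathbf{E}$ is a set $\mathcal{X}\subseteq[m+n]$ such that for all $i\in[m]$, $j\in[n]$: $e_{ij}\neq 0$ implies $i\in\mathcal{X}$ or $m+j\in\mathcal{X}$. The cover weight $\mathrm{wt}_C(\mathbf{E})$ is the minimum cardinality of a cover of $\mathbf{E}$. The cover distance of $\mathbf{A},\mathbf{B}\in\mathbb{F}_q^{m\times n}$ is $\mathrm{wt}_C(\mathbf{A}-\mathbf{B})$. A linear cover-metric code of dimension $k$ is an $\mathbb{F}_q$-linear subspace $\mathbb{C}$ of $\mathbb{F}_q^{n\times n}$ of dimension $k$; its minimum cover distance is $d_C(\mathbb{C})=\min_{\mathbf{A}\in\mathbb{C},\,\mathbf{A}\neq\mathbf{0}}\mathrm{wt}_C(\mathbf{A})$.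 The same definition of minimum cover distance is used for linear codes of rectangular matrices. Cover-locality: the code $\mathbb{C}$ has $(r,\rho)$ cover-locality if for every line $i\in[2n]$ there exists a set $\Gamma(i)$ of indices of pairwise non-intersecting lines (i.e., $\Gamma(i)$ consists only of rows if $i$ is a row, and only of columns if $i$ is a column) such that (1) $i\in\Gamma(i)$; (2) $|\Gamma(i)|\leq r+\rho-1$; (3) $d_C(\mathbb{C}|_{\Gamma(i)})\geq\rho$. Here $\mathbb{C}|_{\Gamma(i)}$ is the code of matrices of size $|\Gamma(i)|\times n$ (rows) or $n\times|\Gamma(i)|$ (columns) obtained by restricting every codeword of $\mathbb{C}$ to the lines in $\Gamma(i)$. *)

(* Defs.v *)
From mathcomp Require Import all_boot all_order all_algebra.
From mathcomp Require Export constructive_ereal.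

Set Implicit Arguments.
Unset Strict Implicit.
Unset Printing Implicit Defensive.

Import Order.TTheory GRing.Theory Num.Theory.
Local Open Scope ring_scope.

(* The lines of an m x n matrix are indexed by 'I_(m + n): row i is
   [lshift n i] and column j is [rshift m j]. *)
Definition is_cover (F : finFieldType) (m n : nat) (E : 'M[F]_(m, n))
    (X : {set 'I_(m + n)}) : bool :=
  [forall i, forall j,
     (E i j != 0) ==> (lshift n i \in X) || (rshift m j \in X)].

Definition cover_weight (F : finFieldType) (m n : nat) (E : 'M[F]_(m, n)) : nat :=
  #|[arg min_(X < [set: 'I_(m + n)] | is_cover E X) #|X| ]|.

(* The minimum is taken in \bar rat so that the zero code, which has no
   nonzero codeword, gets the empty minimum +oo. *)
Definition min_cover_dist (F : finFieldType) (m n : nat)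
    (C : {vspace 'M[F]_(m, n)}) : \bar rat :=
  \big[mine/+oo%E]_(A : 'M[F]_(m, n) | (A \in C) && (A != 0))
     (cover_weight A)%:R%:E.

Definition restrict_rows (F : finFieldType) (m n : nat)
    (C : {vspace 'M[F]_(m, n)}) (G : {set 'I_m}) : {vspace 'M[F]_(#|G|, n)} :=
  (linfun (rowsub (@enum_val _ (mem G)) :
             'M[F]_(m, n) -> 'M[F]_(#|G|, n)) @: C)%VS.

Definition restrict_cols (F : finFieldType) (m n : nat)
    (C : {vspace 'M[F]_(m, n)}) (G : {set 'I_n}) : {vspace 'M[F]_(m, #|G|)} :=
  (linfun (colsub (@enum_val _ (mem G)) :
             'M[F]_(m, n) -> 'M[F]_(m, #|G|)) @: C)%VS.

(* Pairwise non-intersecting lines are all rows or all columns, so the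
   repair set of a row is a set of row indices, and that of a column a set of
   column indices. *)
Definition cover_locality (F : finFieldType) (n : nat)
    (C : {vspace 'M[F]_n}) (r rho : nat) : Prop :=
  (forall i : 'I_n, exists G : {set 'I_n},
     [/\ i \in G, (#|G| <= r + rho - 1)%N &
         (rho%:R%:E <= min_cover_dist (restrict_rows C G))%E]) /\
  (forall j : 'I_n, exists G : {set 'I_n},
     [/\ j \in G, (#|G| <= r + rho - 1)%N &
         (rho%:R%:E <= min_cover_dist (restrict_cols C G))%E]).

(* Main.v *)
Require Import Defs.
From mathcomp Require Import all_boot all_order all_algebra.
From mathcomp Require Import zify lra.

(** A nonzero codeword vanishing on a set [S] of rows has cover weight at most
    [n - #|S|], so it suffices to find a large [S] on which some nonzero codeword
    vanishes.  Imposing one further zero row lowers the dimension by at most [n].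
    A repair set has minimum distance at least [rho], so any [rho - 1] of its rows
    are determined by the others and impose no further condition: adjoining to [S]
    a repair set not yet determined by [S] brings [rho - 1] zero rows for free, and
    lowers the dimension by at most [n * r].  This can be done
    [ceil (k / (n * r)) - 1] times before the code is exhausted; then rows are
    added one at a time until the dimension would drop to 0. *)

Set Implicit Arguments.
Unset Strict Implicit.
Unset Printing Implicit Defensive.

Import Order.TTheory GRing.Theory Num.Theory.
Local Open Scope ring_scope.

Lemma exists_subset_card (T : finType) (A : {set T}) (m : nat) :
  (m <= #|A|)%N -> exists2 B : {set T}, B \subset A & #|B| = m.
Proof.
move=> le_mA; exists [set x in take m (enum A)].
  by apply/subsetP => x; rewrite inE => /mem_take; rewrite mem_enum.
rewrite cardsE (card_uniqP _) ?take_uniq ?enum_uniq // size_take -cardE.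
by case: ltngtP le_mA.
Qed.

Section CoverDistance.

Variables (F : finFieldType) (m n : nat).
Implicit Types (C : {vspace 'M[F]_(m, n)}) (S : {set 'I_m}).

Lemma cover_weight_le (E : 'M[F]_(m, n)) (X : {set 'I_(m + n)}) :
  is_cover E X -> (cover_weight E <= #|X|)%N.
Proof.
rewrite /cover_weight; case: arg_minnP => [|Y _ minY /minY //].
(* The default value of the minimum, the set of all lines, is itself a cover. *)
by apply/'forall_forallP => i j; rewrite !inE implybT.
Qed.

Lemma cover_weight_le_rows (E : 'M[F]_(m, n)) S :
  (forall i, i \notin S -> row i E = 0) -> (cover_weight E <= #|S|)%N.
Proof.
move=> E0; rewrite -(card_imset S (@lshift_inj m n)); apply: cover_weight_le.
apply/'forall_forallP => i j; apply/implyP => Eij.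
rewrite mem_imset; last exact: lshift_inj.
apply/orP; left; apply: contraNT Eij => /E0 /rowP/(_ j).
by rewrite !mxE => ->.
Qed.

Lemma min_cover_dist_le C (A : 'M[F]_(m, n)) :
  A \in C -> A != 0 -> (min_cover_dist C <= (cover_weight A)%:R%:E)%E.
Proof. by move=> CA A0; apply: bigmin_le_cond; rewrite CA. Qed.

End CoverDistance.

Section Shortening.

Variables (F : finFieldType) (m n : nat).
Implicit Types (C : {vspace 'M[F]_(m, n)}) (S T G E : {set 'I_m}).

(** The zero rows are kept rather than deleted, so that the subcodes for all [S] lie in one space
    and can be compared. *)
Definition shortening C S : {vspace 'M[F]_(m, n)} :=
  (C :&: \bigcap_(i in S) lker (linfun (row i : 'M[F]_(m, n) -> 'rV[F]_n)))%VS.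

Lemma mem_shortening C S A :
  reflect (A \in C /\ forall i, i \in S -> row i A = 0) (A \in shortening C S).
Proof.
rewrite memv_cap memvE; apply: (iffP andP) => -[CA /= A0]; split=> //.
  move=> i iS; move/subv_bigcapP: A0 => /(_ i iS).
  by rewrite -memvE memv_ker lfunE => /eqP.
by apply/subv_bigcapP => i /A0 Ai; rewrite -memvE memv_ker lfunE /= Ai.
Qed.

Lemma shortening0 C : shortening C set0 = C.
Proof.
by apply/vspaceP => A; apply/mem_shortening/idP => [[]|CA] //; split=> // i; rewrite inE.
Qed.

Lemma shorteningU1 C S i :
  shortening C (i |: S) =
  (shortening C S :&: lker (linfun (row i : 'M[F]_(m, n) -> 'rV[F]_n)))%VS.
Proof.
apply/vspaceP => A; rewrite memv_cap memv_ker lfunE /=.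
apply/mem_shortening/andP => [[CA A0]|[/mem_shortening[CA A0] /eqP Ai]].
  split; last by rewrite A0 ?setU11.
  by apply/mem_shortening; split=> // j jS; rewrite A0 // setU1r.
by split=> // j /setU1P[->|/A0].
Qed.

(** Rank-nullity for the map [row i], whose image has dimension at most [n]. *)
Lemma dim_shorteningU1 C S i :
  (\dim (shortening C S) <= \dim (shortening C (i |: S)) + n)%N.
Proof.
rewrite -(limg_ker_dim (linfun (row i : 'M[F]_(m, n) -> 'rV[F]_n)) (shortening C S)).
rewrite -shorteningU1 leq_add2l (leq_trans (dimvS (subvf _))) //.
by rewrite dimvf /dim /= mul1n.
Qed.

Lemma dim_shorteningU C S T :
  (\dim (shortening C S) <= \dim (shortening C (S :|: T)) + n * #|T|)%N.
Proof.
elim: {T}#|T| {-2}T (leqnn #|T|) => [T|c IH T leT].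
  by rewrite leqn0 cards_eq0 => /eqP->; rewrite setU0 leq_addr.
have [->|[i iT]] := set_0Vmem T; first by rewrite setU0 leq_addr.
have := IH (T :\ i); have := dim_shorteningU1 C (S :|: T :\ i) i.
rewrite setUCA setD1K //; move: leT; rewrite (cardsD1 i T) iT.
by rewrite mulnDr muln1; lia.
Qed.

(** The rows outside [S] cover [A]. *)
Lemma min_cover_dist_shortening C S A :
  A \in shortening C S -> A != 0 -> (min_cover_dist C <= (m - #|S|)%:R%:E)%E.
Proof.
move=> /mem_shortening[CA A0] nzA.
apply: le_trans (min_cover_dist_le CA nzA) _; rewrite lee_fin ler_nat.
have -> : (m - #|S|)%N = #|~: S| by rewrite [RHS]cardsCs setCK card_ord.
apply: cover_weight_le_rows => i.
by rewrite inE negbK; apply: A0.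
Qed.

(** The restriction of [A] to [G] is covered by the rows in [G :\: T], fewer than [rho] of them, so
    the distance bound forces it to be zero. *)
Lemma row_repair C G T (rho : nat) A :
    (rho%:R%:E <= min_cover_dist (restrict_rows C G))%E ->
    (#|G :\: T| < rho)%N ->
    A \in C -> (forall i, i \in G :&: T -> row i A = 0) ->
  forall i, i \in G -> row i A = 0.
Proof.
move=> distG ltGT CA A0 i iG.
pose f : 'I_#|G| -> 'I_m := @enum_val _ (mem G).
pose B : 'M[F]_(#|G|, n) := rowsub f A.
have CB : B \in restrict_rows C G.
  by apply/memv_imgP; exists A => //; rewrite lfunE.
have [B0|nzB] := eqVneq B 0.
  apply/rowP => j; have /matrixP/(_ (enum_rank_in iG i) j) := B0.
  by rewrite !mxE /f enum_rankK_in.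
have := le_trans distG (min_cover_dist_le CB nzB).
rewrite lee_fin ler_nat leqNgt; case/negP; apply: leq_ltn_trans ltGT.
have fK : injective f by apply: enum_val_inj.
apply: (@leq_trans #|f @^-1: (G :\: T)|); last first.
  rewrite -(card_imset _ fK) subset_leq_card //.
  by apply/subsetP => _ /imsetP[x + ->]; rewrite inE.
apply: cover_weight_le_rows => x; rewrite inE => xGT.
have fG : f x \in G by apply: enum_valP.
have/A0/rowP fT : f x \in G :&: T.
  by move: xGT; rewrite !inE fG andbT negbK.
by apply/rowP => j; have := fT j; rewrite !mxE.
Qed.

Lemma shortening_repair C S G E (rho : nat) :
    (rho%:R%:E <= min_cover_dist (restrict_rows C G))%E ->
    (#|E| < rho)%N -> G \subset S :|: E ->
  shortening C (S :|: G) = shortening C S.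
Proof.
move=> distG ltE sGSE; apply/vspaceP => A.
apply/mem_shortening/mem_shortening => -[CA A0]; split=> // i.
  by move=> iS; rewrite A0 // inE iS.
case/setUP => [/A0//|]; apply: (row_repair (T := S) distG _ CA) => [|j].
  apply: leq_ltn_trans ltE; apply/subset_leq_card/subsetP => j.
  by case/setDP => /(subsetP sGSE)/setUP[->|].
by case/setIP => _ /A0.
Qed.

(** One greedy step, with [S'] the union of [S] and a repair set. The first bound limits the loss of
    dimension; the second says that [n * #|S| + \dim (shortening C S)] grows by at least
    [n * (rho - 1)]. *)
Lemma shortening_extend C S (r rho : nat) :
    (0 < rho)%N ->
    (forall i : 'I_m, exists G : {set 'I_m},
       [/\ i \in G, (#|G| <= r + rho - 1)%N &
           (rho%:R%:E <= min_cover_dist (restrict_rows C G))%E]) ->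
    shortening C S != 0%VS ->
  exists S' : {set 'I_m},
    (\dim (shortening C S) <= \dim (shortening C S') + n * r)%N /\
    (n * #|S| + n * (rho - 1) + \dim (shortening C S) <=
       n * #|S'| + \dim (shortening C S'))%N.
Proof.
move=> rho_gt0 locC nzS; set A := vpick (shortening C S).
have /mem_shortening[CA AS] : A \in shortening C S by apply: memv_pick.
have /rowV0Pn[_ /submxP[v ->] vA] : A != 0 by rewrite vpick0.
have [i Ai] : exists i, row i A != 0.
  apply/existsP; apply: contraNT vA => /existsPn A0.
  suff -> : A = 0 by rewrite mulmx0.
  by apply/row_matrixP => i; rewrite row0; apply/eqP/negPn/A0.
have [G [iG leG distG]] := locC i; pose D := G :\: S.
(* With fewer than [rho] rows of [G] outside [S], [row_repair] would make row [i] of [A] vanish. *)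
have rhoD : (rho <= #|D|)%N.
  rewrite leqNgt; apply: contra_neqN Ai => ltD.
  by apply: (row_repair (T := S) distG ltD CA _ iG) => j /setIP[_ /AS].
(* The rows of [E] come for free: only the [#|D| - (rho - 1)] rows of [D :\: E], at most [r], can
   lower the dimension. *)
have [E sED cardE] := @exists_subset_card _ D (rho - 1) (leq_trans (leq_subr _ _) rhoD).
have GSE : shortening C (S :|: G) = shortening C (S :|: (D :\: E)).
  have <- : S :|: (D :\: E) :|: G = S :|: G.
    apply/setP => j; rewrite !inE.
    by case: (j \in S); case: (j \in E); case: (j \in G).
  apply: (@shortening_repair _ _ _ E rho) => //; first by lia.
  apply/subsetP => j jG; rewrite !inE jG.
  by case: (j \in S); case: (j \in E).
have leD : (#|D| <= #|G|)%N by rewrite subset_leq_card // subsetDl.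
have cardDE : #|D :\: E| = (#|D| - (rho - 1))%N.
  by rewrite cardsDS // cardE.
have cardSG : #|S :|: G| = (#|S| + #|D|)%N.
  by have := subset_leq_card (subsetIl G S); rewrite cardsU cardsD setIC; lia.
have := dim_shorteningU C S (D :\: E); rewrite -GSE cardDE => dimS.
exists (S :|: G); split.
  by apply: leq_trans dimS _; rewrite leq_add2l leq_mul2l; lia.
rewrite cardSG; nia.
Qed.

Lemma exists_large_shortening C (r rho l : nat) :
    (0 < rho)%N ->
    (forall i : 'I_m, exists G : {set 'I_m},
       [/\ i \in G, (#|G| <= r + rho - 1)%N &
           (rho%:R%:E <= min_cover_dist (restrict_rows C G))%E]) ->
    (l * (n * r) < \dim C)%N ->
  exists2 S : {set 'I_m}, shortening C S != 0%VS &
    (\dim C + l * (n * (rho - 1)) <= n * #|S| + n)%N.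
Proof.
move=> rho_gt0 locC lt_l.
(* Here [j] counts the repair sets adjoined so far. *)
pose P j S := (\dim (shortening C S) > 0)%N &&
  (\dim C + j * (n * (rho - 1)) <= n * #|S| + \dim (shortening C S))%N.
have [S0 PS0] : exists S, P l S.
  suff /(_ l (leqnn _)) [S [dimS1 dimS2]] : forall j, (j <= l)%N -> exists S,
      (\dim C <= \dim (shortening C S) + j * (n * r))%N /\
      (\dim C + j * (n * (rho - 1)) <= n * #|S| + \dim (shortening C S))%N.
    by exists S; apply/andP; split=> //; lia.
  elim=> [_|j IH lt_jl].
    by exists set0; rewrite shortening0 cards0 muln0 !addn0.
  have [S [dimS1 dimS2]] := IH (ltnW lt_jl).
  (* After [j < l] steps at most [j * (n * r)] dimensions are lost, which is less than [\dim C]. *)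
  have nzS : shortening C S != 0%VS.
    by rewrite -dimv_eq0 -lt0n; nia.
  have [S' [dimS'1 dimS'2]] := shortening_extend rho_gt0 locC nzS.
  by exists S'; rewrite !mulSn; split; lia.
(* Adding a row preserves the second conjunct of [P l], since [n * #|S|] gains [n] and the dimension
   drops by at most [n]. For a maximal [S] a further row must therefore kill the code, whose
   dimension is then at most [n]. *)
have [S /maxsetP[/andP[dimS1 dimS2] maxS]] := ex_maxset (ex_intro _ S0 PS0).
exists S; first by rewrite -dimv_eq0 -lt0n.
have [i iS] : exists i, i \notin S.
  apply/existsP; apply: contraTT dimS1 => /existsPn allS.
  rewrite -leqNgt leqn0 dimv_eq0 -vpick0; apply/eqP/row_matrixP => i.
  rewrite row0; have/mem_shortening[_] := memv_pick (shortening C S).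
  by apply; apply/negPn/allS.
have := dim_shorteningU1 C S i.
have : ~~ P l (i |: S).
  apply: contraNN iS => /maxS /(_ (subsetUr _ _)) <-.
  by rewrite setU11.
rewrite /P cardsU1 iS mulnDr muln1; lia.
Qed.

End Shortening.

Theorem theorem1 (F : finFieldType) (n k r rho : nat) (C : {vspace 'M[F]_n})
    (n_gt0 : (0 < n)%N) (k_gt0 : (0 < k)%N)
    (r_gt0 : (0 < r)%N) (rho_gt0 : (0 < rho)%N)
    (dimC : \dim C = k) (locC : cover_locality C r rho) :
  (min_cover_dist C <=
   (n%:R - k%:R / n%:R + 1
    - ((Num.ceil (k%:R / (n * r)%:R : rat))%:~R - 1) * (rho%:R - 1))%:E)%E.
Proof.
set x : rat := k%:R / (n * r)%:R.
have nr_gt0 : (0 < (n * r)%:R :> rat) by rewrite ltr0n muln_gt0 n_gt0.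
have x_gt0 : 0 < x by rewrite divr_gt0 // ltr0n.
(* The number of greedy steps; it is a natural number because [x > 0] makes the ceiling at least 1,
   and [l < x] then gives the room required for [l] steps. *)
have [l defl] : exists l : nat, Num.ceil x = l%:Z + 1.
  by exists `|Num.ceil x - 1|%N; have := ceil_gt0 x; rewrite x_gt0; lia.
have lt_l : (l * (n * r) < \dim C)%N.
  have := ceilB1_lt x; rewrite defl addrK ltr_pdivlMr //.
  by rewrite -[l%:~R]/(l%:R) -natrM ltr_nat dimC.
have [S nzS leS] := exists_large_shortening rho_gt0 locC.1 lt_l.
have := min_cover_dist_shortening (memv_pick (shortening C S)).
rewrite vpick0 => /(_ nzS) dist_le; apply: le_trans dist_le _.
have leSn : (#|S| <= n)%N by rewrite -[n in (_ <= n)%N]card_ord max_card.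
rewrite lee_fin defl intrD addrK -[l%:~R]/(l%:R) natrB //.
have n_gt0' : (0 < n%:R :> rat) by rewrite ltr0n.
(* This is [leS] divided by [n]. *)
suff : k%:R / n%:R + l%:R * (rho%:R - 1) <= #|S|%:R + 1 :> rat by lra.
rewrite -(ler_pM2r n_gt0') mulrDl divfK ?lt0r_neq0 //.
have := leS; rewrite dimC -(ler_nat rat) !natrD !natrM natrB //.
lra.
Qed.
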